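(* Let $E\to M$ be a Courant algebroid that is reducible with respect to geometric coisotropic data $(N,K,F,\nabla)$, where $F$ is simple and $\nabla$ has trivial holonomy, and let $E_{red}\to\underline N$ be the reduced Courant algebroid. If a generalized complex structure $\mathbb J\colon E\to E$ satisfies either of the equivalent conditions (a) $\mathbb J(\Gamma^{flat}_{E,K^\perp})\subseteq\Gamma^{flat}_{E,K^\perp}$, or (b) $\mathbb J(K)\subseteq K$ and $\nabla\mathbb J_{quot}=0$, where $\mathbb J_{quot}([e])=[\mathbb J(e)]$ on $E_{quot}=K^\perp/K$, then it gives rise to a generalized complex structure $\mathbb J_{red}$ on $E_{red}$ by $$p^\sharp\mathbb J_{red}(\underline e)=[\mathbb J(e)],$$ where $\underline e$ is a section of $E_{red}$ and $e$ is a section of $K^\perp$ such that $[e]=p^\sharp\underline e$.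
   Context: Manifolds and vector bundles are smooth and real; $\Gamma_A$ is the sheaf of sections of $A$. **Courant algebroid.** A vector bundle $E\to M$ with a fiberwise symmetric non-degenerate form $\langle\cdot,\cdot\rangle$, a bundle map $\rho\colon E\to TM$ (anchor) and a bilinear bracket on $\Gamma(E)$ with: $[\![e_1,[\![e_2,e_3]\!]]\!]=[\![[\![e_1,e_2]\!],e_3]\!]+[\![e_2,[\![e_1,e_3]\!]]\!]$; $[\![e_1,fe_2]\!]=f[\![e_1,e_2]\!]+(\mathcal L_{\rho(e_1)}f)e_2$; $\mathcal L_{\rho(e_1)}\langle e_2,e_3\rangle=\langle[\![e_1,e_2]\!],e_3\rangle+\langle e_2,[\![e_1,e_3]\!]\rangle$; $\rho([\![e_1,e_2]\!])=[\rho(e_1),\rho(e_2)]$; $\langle e_1,[\![e_2,e_2]\!]\rangle=\frac12\mathcal L_{\rho(e_1)}\langle e_2,e_2\rangle$. **Generalized complex structure** on $E$: an endomorphism $\mathbb J\colon E\to E$ with $\mathbb J^2=-\mathrm{Id}$, $\mathbb J=-\mathbb J^*$ and vanishing Nijenhuis torsion, $[\![\mathbb J e_1,\mathbb J e_2]\!]-\mathbb J[\![\mathbb J e_1,e_2]\!]-\mathbb J[\![e_1,\mathbb J e_2]\!]-[\![e_1,e_2]\!]=0$. **Geometric coisotropic data** $(N,K,F,\nabla)$: $N\subseteq M$ a submanifold; $K\subseteq E|_N$ an isotropic subbundle; $F\subseteq TN$ an integrable subbundle; $\nabla$ a flat $F$-connection on $E_{quot}=K^\perp/K\to N$ preserving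 the induced metric. $[\cdot]\colon K^\perp\to E_{quot}$ is the projection. $\Gamma_{A,B}$ denotes sections of $A\to M$ whose restriction to $N$ lies in $B\to N$; $\Gamma^{flat}_{E,K^\perp}$ is the sheaf of $e\in\Gamma_{E,K^\perp}$ with $[e|_N]$ $\nabla$-flat. $\nabla\mathbb J_{quot}=0$ means $\nabla_Z$ commutes with $\mathbb J_{quot}$ for all $Z\in\Gamma_F$. **Simple, trivial holonomy, quotient.** $F$ is simple if there is a surjective submersion $p\colon N\to\underline N$ with connected fibres and $\ker dp=F$. With $\mathcal R_p=N\times_{\underline N}N$ the submersion groupoid, $\nabla$ has trivial holonomy if it arises by differentiation from a representation of $\mathcal R_p$ on $E_{quot}$; equivalently there is a vector bundle $E_{red}\to\underline N$ (unique up to isomorphism; the quotient of $E_{quot}$ with respect to $F$ and $\nabla$) with $E_{quot}\cong p^*E_{red}$ and such that the pullback of sections $p^\sharp$ is an isomorphism from $\Gamma_{E_{red}}$ onto $p_*$ of the sheaf of $\nabla$-flat sections of $E_{quot}$. $E_{red}$ inherits a pseudo-euclidean structure. **Reducibility.** $E$ is reducible with respect to $(N,K,F,\nabla)$ if $\rho(K^\perp)\subseteq TN$, $\rho(K)\subseteq F$, $[\rho(\Gamma^{flat}_{E,K^\perp}),\Gamma_{TM,F}]\subseteq\Gamma_{TM,F}$, and $[\![\Gamma^{flat}_{E,K^\perp},\Gamma^{flat}_{E,K^\perp}]\!]\subseteq\Gamma^{flat}_{E,K^\perp}$. Then $E_{red}$ is a Courant algebroid (the reduced Courant algebroid) with $\rho_{red}(\underline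 e)=p_*(\rho(e))$ and $p^\sharp[\![\underline e_1,\underline e_2]\!]_{red}=\big[[\![e_1,e_2]\!]|_N\big]$, where $e$ is a section of $K^\perp$ with $[e]=p^\sharp\underline e$ and $e_i\in\Gamma^{flat}_{E,K^\perp}$ with $[e_i|_N]=p^\sharp\underline e_i$. *)

(* Defs.v *)
(* A manifold is presented by its sheaf of smooth functions and a vector      *)
(* bundle by its sheaf of smooth sections.  Local functions and sections are  *)
(* represented by globally defined (possibly non-smooth) ones, and the        *)
(* sheaves by germ predicates: smooth at x always means smooth on some        *)
(* neighbourhood of x.  Operators on local sections (brackets, connections)   *)
(* act on such representatives and are required to depend on germs only,      *)
(* which is the same thing as a morphism of sheaves; their values on          *)
(* non-smooth germs are irrelevant.                                           *)
From HB Require Import structures.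
From mathcomp Require Import all_boot all_order all_algebra.
From mathcomp Require Import all_classical all_reals all_analysis.
Set Implicit Arguments.
Unset Strict Implicit.
Unset Printing Implicit Defensive.
Import Order.TTheory GRing.Theory Num.Theory numFieldNormedType.Exports.
Local Open Scope classical_set_scope.
Local Open Scope ring_scope.

Section SmoothRn.
Context {R : realType} {n : nat}.

Fixpoint Ck (k : nat) (U : set 'rV[R]_n) (f : 'rV[R]_n -> R) : Prop :=
  (forall a, U a -> {for a, continuous f}) /\
  if k is k'.+1 then
    forall j : 'I_n, (forall a, U a -> derivable f a 'e_j) /\
                     Ck k' U (fun a => 'D_('e_j) f a)
  else True.

Definition smoothR (a : 'rV[R]_n) (f : 'rV[R]_n -> R) : Prop :=
  exists U : set 'rV[R]_n, [/\ open U, U a & forall k, Ck k U f].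

End SmoothRn.

(* [U] is an open subset on which [phi] restricts to an isomorphism of spaces *)
(* with functions onto an open subset of R^n.                                 *)
Definition is_chart {R : realType} {T : topologicalType}
    (smooth : T -> (T -> R) -> Prop) (n : nat) (U : set T)
    (phi : T -> 'rV[R]_n) : Prop :=
  [/\ open U, set_inj U phi, forall x, U x -> {for x, continuous phi},
      forall W, open W -> W `<=` U -> open (phi @` W)
    & forall x f, U x -> smooth x f <->
        exists2 g, smoothR (phi x) g & \forall y \near x, f y = g (phi y)].

(* The dimension is only required to be locally constant. *)
Record manifold (R : realType) := Manifold {
  mcarrier :> topologicalType;
  smooth_at : mcarrier -> (mcarrier -> R) -> Prop;
  _ : hausdorff_space mcarrier;
  _ : @second_countable mcarrier;
  _ : forall x, exists n U (phi : mcarrier -> 'rV[R]_n),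
        U x /\ is_chart smooth_at U phi }.
Arguments smooth_at {R m} _ _.

Definition smooth_map {R : realType} {M N : manifold R} (phi : M -> N) : Prop :=
  continuous phi /\
  forall x g, smooth_at (phi x) g -> smooth_at x (fun y => g (phi y)).

(* A tangent vector at x is a derivation at x of the algebra of germs of      *)
(* smooth functions.  It is extended by 0 to functions that are not smooth    *)
(* near x, so that it is determined by its values on smooth germs.            *)
Section Tangent.
Context {R : realType} {M : manifold R}.

Definition derivation_at (x : M) (D : (M -> R) -> R^o) : Prop :=
  [/\ forall f, ~ smooth_at x f -> D f = 0,
      forall f g, (\forall y \near x, f y = g y) -> D f = D g,
      forall a f g, smooth_at x f -> smooth_at x g ->
        D (fun y => a * f y + g y) = a * D f + D g
    & forall f g, smooth_at x f -> smooth_at x g ->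
        D (fun y => f y * g y) = D f * g x + f x * D g].

Definition derivations (x : M) : {pred (M -> R) -> R^o} :=
  fun D => `[< derivation_at x D >].

Fact derivations_submod x : submod_closed (derivations x).
Proof.
have zE h : (0 : (M -> R) -> R^o) h = 0 by [].
have sE a (D D' : (M -> R) -> R^o) h : (a *: D + D') h = a * D h + D' h by [].
split=> [|a D D' /asboolP[D0 Dl Da Dm] /asboolP[D0' Dl' Da' Dm']];
  apply/asboolP; split.
- by [].
- by [].
- by move=> b f g _ _; rewrite !zE mulr0 addr0.
- by move=> f g _ _; rewrite !zE mul0r mulr0 addr0.
- by move=> f nf; rewrite sE D0 // D0' // mulr0 addr0.
- by move=> f g fg; rewrite !sE (Dl _ _ fg) (Dl' _ _ fg).
- by move=> b f g sf sg; rewrite !sE Da // Da' // !mulrDr addrACA mulrCA.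
- move=> f g sf sg; rewrite !sE Dm // Dm' //.
  by rewrite !mulrDr mulrDl addrACA !mulrA (mulrC a (f x)).
Qed.

HB.instance Definition _ (x : M) :=
  GRing.isSubmodClosed.Build R ((M -> R) -> R^o) (derivations x)
    (derivations_submod x).

Record tangent (x : M) := Tangent {
  tval :> (M -> R) -> R^o;
  _ : tval \in derivations x }.

HB.instance Definition _ (x : M) := [isSub for @tval x].
HB.instance Definition _ (x : M) := [Choice of tangent x by <:].
HB.instance Definition _ (x : M) := [SubChoice_isSubLmodule of tangent x by <:].

(* The tangent vector acting by D on smooth germs.  It makes sense only when  *)
(* D is a derivation on these, and is 0 by convention otherwise.              *)
Definition mk_tangent (x : M) (D : (M -> R) -> R) : tangent x :=
  insubd (0 : tangent x) (fun f => if `[< smooth_at x f >] then D f else 0).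

End Tangent.
Arguments tangent {R} M x.

(* A family of vector spaces with a notion of smooth section. *)
Record vfamily (R : realType) (M : manifold R) := VFamily {
  fiber :> M -> lmodType R;
  ssmooth_at : forall x : M, (forall y, fiber y) -> Prop }.

Notation sect A := (forall x, fiber A x).

Definition smooth_on {R : realType} {M : manifold R} (A : vfamily M)
    (U : set M) (s : sect A) : Prop :=
  forall x, U x -> ssmooth_at x s.

Definition is_basis {R : realType} {V : lmodType R} {r : nat}
    (b : 'I_r -> V) (S : set V) : Prop :=
  (forall c : 'I_r -> R, \sum_j c j *: b j = 0 -> forall j, c j = 0) /\
  (forall v, S v <-> exists c : 'I_r -> R, v = \sum_j c j *: b j).

(* A vector bundle is a family admitting smooth local frames.  The condition  *)
(* on [ssmooth_at] also makes it a property of germs.                         *)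
Record vbundle (R : realType) (M : manifold R) := VBundle {
  vfam :> vfamily M;
  _ : forall x : M, exists r (b : 'I_r -> sect vfam), \forall y \near x,
        is_basis (fun j => b j y) setT /\
        forall s : sect vfam, ssmooth_at y s <->
          exists2 c : 'I_r -> M -> R, forall j, smooth_at y (c j)
            & \forall z \near y, s z = \sum_j c j z *: b j z }.

Definition subbundle {R : realType} {M : manifold R} (A : vfamily M)
    (S : forall x, set (A x)) : Prop :=
  forall x : M, exists r (b : 'I_r -> sect A), \forall y \near x,
    (forall j, ssmooth_at y (b j)) /\ is_basis (fun j => b j y) (S y).

Definition pullback {R : realType} {M N : manifold R} (phi : N -> M)
    (A : vfamily M) : vfamily N :=
  @VFamily R N (fun x => A (phi x)) (fun x s =>
    exists r (c : 'I_r -> N -> R) (b : 'I_r -> sect A),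
      [/\ forall j, smooth_at x (c j), forall j, ssmooth_at (phi x) (b j)
        & \forall y \near x, s y = \sum_j c j y *: b j (phi y)]).

Definition TM {R : realType} (M : manifold R) : vfamily M :=
  @VFamily R M (fun x => tangent M x) (fun x X =>
    forall f, smooth_at x f -> smooth_at x (fun y => X y f)).

Definition dmap {R : realType} {M N : manifold R} (phi : M -> N) (x : M)
    (v : tangent M x) : tangent N (phi x) :=
  mk_tangent (phi x) (fun g => v (fun y => g (phi y))).

Definition lie {R : realType} {M : manifold R} (X Y : sect (TM M)) :
    sect (TM M) :=
  fun x => mk_tangent x (fun f =>
    X x (fun y => Y y f) - Y x (fun y => X y f)).

(* An embedded submanifold, as the injective image of a manifold N: around    *)
(* each of its points M has a chart in which N is a slice R^n x 0 and which   *)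
(* induces a chart of N.                                                      *)
Definition is_submanifold {R : realType} {M N : manifold R} (i : N -> M) :
    Prop :=
  injective i /\
  forall x : N, exists n k (U : set M) (phi : M -> 'rV[R]_(n + k)),
    [/\ U (i x), is_chart smooth_at U phi,
        forall z, U z -> range i z <-> rsubmx (phi z) = 0
      & is_chart smooth_at (i @^-1` U) (fun y => lsubmx (phi (i y)))].

Definition immersion {R : realType} {L N : manifold R} (j : L -> N) : Prop :=
  smooth_map j /\
  forall l (v : tangent L l), dmap j v = 0 -> v = 0.

(* Each point lies on an integral manifold. *)
Definition integrable {R : realType} {N : manifold R}
    (F : forall x, set (TM N x)) : Prop :=
  forall x : N, exists (L : manifold R) (j : L -> N),
    [/\ injective j, immersion j, range j x
      & forall l, F (j l) = range (@dmap R L N j l)].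

(* The bracket is an operator on the sheaf of sections (see above); the Lie   *)
(* derivative of f along rho(e) at x is [anchor (e x) f].                     *)
Record courant (R : realType) (M : manifold R) := Courant {
  cbundle :> vbundle M;
  met : forall x, cbundle x -> cbundle x -> R;
  anchor : forall x, cbundle x -> TM M x;
  br : sect cbundle -> sect cbundle -> sect cbundle;
  _ : forall x (u v : cbundle x), met u v = met v u;
  _ : forall x a (u v w : cbundle x),
        met (a *: u + v) w = a * met u w + met v w;
  _ : forall x (u : cbundle x), (forall v, met u v = 0) -> u = 0;
  _ : forall x (e1 e2 : sect cbundle), ssmooth_at x e1 -> ssmooth_at x e2 ->
        smooth_at x (fun y => met (e1 y) (e2 y));
  _ : forall x, linear (@anchor x);
  _ : forall x (e : sect cbundle), ssmooth_at x e ->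
        @ssmooth_at R M (TM M) x (fun y => anchor (e y));
  _ : forall x (e1 e2 e1' e2' : sect cbundle),
        ssmooth_at x e1 -> ssmooth_at x e2 ->
        (\forall y \near x, e1 y = e1' y) ->
        (\forall y \near x, e2 y = e2' y) -> br e1 e2 x = br e1' e2' x;
  _ : forall x (e1 e2 : sect cbundle), ssmooth_at x e1 -> ssmooth_at x e2 ->
        ssmooth_at x (br e1 e2);
  _ : forall x a (e1 e2 e3 : sect cbundle),
        ssmooth_at x e1 -> ssmooth_at x e2 -> ssmooth_at x e3 ->
        br (fun y => a *: e1 y + e2 y) e3 x = a *: br e1 e3 x + br e2 e3 x;
  _ : forall x a (e1 e2 e3 : sect cbundle),
        ssmooth_at x e1 -> ssmooth_at x e2 -> ssmooth_at x e3 ->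
        br e1 (fun y => a *: e2 y + e3 y) x = a *: br e1 e2 x + br e1 e3 x;
  _ : forall x (e1 e2 e3 : sect cbundle),
        ssmooth_at x e1 -> ssmooth_at x e2 -> ssmooth_at x e3 ->
        br e1 (br e2 e3) x = br (br e1 e2) e3 x + br e2 (br e1 e3) x;
  _ : forall x f (e1 e2 : sect cbundle),
        smooth_at x f -> ssmooth_at x e1 -> ssmooth_at x e2 ->
        br e1 (fun y => f y *: e2 y) x =
          f x *: br e1 e2 x + anchor (e1 x) f *: e2 x;
  _ : forall x (e1 e2 e3 : sect cbundle),
        ssmooth_at x e1 -> ssmooth_at x e2 -> ssmooth_at x e3 ->
        anchor (e1 x) (fun y => met (e2 y) (e3 y)) =
          met (br e1 e2 x) (e3 x) + met (e2 x) (br e1 e3 x);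
  _ : forall x (e1 e2 : sect cbundle), ssmooth_at x e1 -> ssmooth_at x e2 ->
        anchor (br e1 e2 x) =
          lie (fun y => anchor (e1 y)) (fun y => anchor (e2 y)) x;
  _ : forall x (e1 e2 : sect cbundle), ssmooth_at x e1 -> ssmooth_at x e2 ->
        met (e1 x) (br e2 e2 x) =
          2^-1 * anchor (e1 x) (fun y => met (e2 y) (e2 y)) }.
Arguments met {R M c x} _ _.
Arguments anchor {R M c x} _.
Arguments br {R M c} _ _ _.

Record gen_complex {R : realType} {M : manifold R} (E : courant M)
    (J : forall x, E x -> E x) : Prop := GenComplex {
  gc_linear : forall x, linear (@J x);
  gc_smooth : forall x (e : sect E), ssmooth_at x e ->
    @ssmooth_at R M E x (fun y => J y (e y));
  gc_sq : forall x (u : E x), J x (J x u) = - u;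
  gc_skew : forall x (u v : E x), met (J x u) v = - met u (J x v);
  gc_torsion : forall x (e1 e2 : sect E),
    ssmooth_at x e1 -> ssmooth_at x e2 ->
    let Je1 := fun y => J y (e1 y) in
    let Je2 := fun y => J y (e2 y) in
    br Je1 Je2 x - J x (br Je1 e2 x) - J x (br e1 Je2 x) - br e1 e2 x = 0 }.

Definition perp {R : realType} {M N : manifold R} (E : courant M) (i : N -> M)
    (K : forall x, set (E (i x))) (x : N) : set (E (i x)) :=
  [set u | forall v, K x v -> met u v = 0].
Arguments perp {R M N E i} K x _.

(* [Q] is a model of K^perp / K: 0 -> K -> K^perp -> Q -> 0 is an exact       *)
(* sequence of vector bundles and [metQ] the metric induced on Q.  The        *)
(* projection [pr] is only meaningful on K^perp.                              *)
Record is_Equot {R : realType} {M N : manifold R} (E : courant M) (i : N -> M)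
    (K : forall x, set (E (i x))) (Q : vbundle N)
    (pr : forall x, E (i x) -> Q x) (metQ : forall x, Q x -> Q x -> R) : Prop :=
  IsEquot {
  q_linear : forall x a u v, perp K x u -> perp K x v ->
    pr x (a *: u + v) = a *: pr x u + pr x v;
  q_onto : forall x q, exists2 u, perp K x u & pr x u = q;
  q_ker : forall x u, perp K x u -> pr x u = 0 <-> K x u;
  q_smooth : forall x (q : sect Q), ssmooth_at x q <->
    exists2 e : sect (pullback i E), ssmooth_at x e
      & \forall y \near x, perp K y (e y) /\ q y = pr y (e y);
  q_met : forall x u v, perp K x u -> perp K x v ->
    metQ x (pr x u) (pr x v) = met u v }.

(* A flat metric F-connection.  It is C^oo-linear in the direction, hence     *)
(* given by nabla_v q for v in F_x and a local section q.                     *)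
Record is_flat_connection {R : realType} {N : manifold R}
    (F : forall x, set (TM N x)) (Q : vbundle N)
    (metQ : forall x, Q x -> Q x -> R)
    (nabla : forall x, TM N x -> sect Q -> Q x) : Prop := IsFlatConnection {
  n_local : forall x v (q q' : sect Q), F x v -> ssmooth_at x q ->
    (\forall y \near x, q y = q' y) -> nabla x v q = nabla x v q';
  n_linear : forall x a v w (q : sect Q), F x v -> F x w -> ssmooth_at x q ->
    nabla x (a *: v + w) q = a *: nabla x v q + nabla x w q;
  n_add : forall x v (q q' : sect Q),
    F x v -> ssmooth_at x q -> ssmooth_at x q' ->
    nabla x v (fun y => q y + q' y) = nabla x v q + nabla x v q';
  n_leibniz : forall x v f (q : sect Q),
    F x v -> smooth_at x f -> ssmooth_at x q ->
    nabla x v (fun y => f y *: q y) =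
      (v : tangent N x) f *: q x + f x *: nabla x v q;
  n_smooth : forall x (Z : sect (TM N)) (q : sect Q),
    ssmooth_at x Z -> (\forall y \near x, F y (Z y)) -> ssmooth_at x q ->
    @ssmooth_at R N Q x (fun y => nabla y (Z y) q);
  n_flat : forall x (Z W : sect (TM N)) (q : sect Q),
    ssmooth_at x Z -> (\forall y \near x, F y (Z y)) ->
    ssmooth_at x W -> (\forall y \near x, F y (W y)) -> ssmooth_at x q ->
    nabla x (Z x) (fun y => nabla y (W y) q) -
      nabla x (W x) (fun y => nabla y (Z y) q) = nabla x (lie Z W x) q;
  n_metric : forall x v (q q' : sect Q),
    F x v -> ssmooth_at x q -> ssmooth_at x q' ->
    (v : tangent N x) (fun y => metQ y (q y) (q' y)) =
      metQ x (nabla x v q) (q' x) + metQ x (q x) (nabla x v q') }.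

Record coisotropic_data (R : realType) (M : manifold R) (E : courant M) :=
  CoisotropicData {
  cN : manifold R;
  cincl : cN -> M;
  cK : forall x, set (E (cincl x));
  cF : forall x, set (TM cN x);
  cQ : vbundle cN;
  cpr : forall x, E (cincl x) -> cQ x;
  cmet : forall x, cQ x -> cQ x -> R;
  cnabla : forall x, TM cN x -> sect cQ -> cQ x;
  c_sub : is_submanifold cincl;
  c_K : @subbundle R cN (pullback cincl E) (@cK);
  c_isotropic : forall x u v, @cK x u -> @cK x v -> met u v = 0;
  c_F : subbundle cF;
  c_integrable : integrable cF;
  c_quot : is_Equot cK cpr cmet;
  c_nabla : is_flat_connection cF cmet cnabla }.
Arguments cincl {R M E} D x : rename.
Arguments cK {R M E} D x _ : rename.
Arguments cF {R M E} D x _ : rename.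
Arguments cpr {R M E} D {x} u : rename.
Arguments cmet {R M E} D {x} q q' : rename.
Arguments cnabla {R M E} D {x} v q : rename.

Section Reduction.
Context {R : realType} {M : manifold R} {E : courant M}.
Variable D : coisotropic_data E.
Local Notation N := (cN D).
Local Notation i := (cincl D).
Local Notation K := (cK D).
Local Notation F := (cF D).
Local Notation Q := (cQ D).
Local Notation pr := (cpr D).

Definition flat_on (V : set N) (q : sect Q) : Prop :=
  smooth_on V q /\ forall x v, V x -> F x v -> cnabla D v q = 0.

(* Sections over the open set U of the sheaf Gamma^flat_{E,K^perp}. *)
Definition flat_lift (U : set M) (e : sect E) : Prop :=
  [/\ smooth_on U e, forall x, U (i x) -> perp K x (e (i x))
    & flat_on (i @^-1` U) (fun x => pr (e (i x)))].

(* Sections over the open set U of the sheaf Gamma_{TM,F}. *)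
Definition vf_in_F (U : set M) (X : sect (TM M)) : Prop :=
  smooth_on U X /\
  forall x, U (i x) -> exists2 v, F x v & X (i x) = dmap i v.

Definition reducible : Prop :=
  [/\ forall x u, perp K x u -> exists v : tangent N x, anchor u = dmap i v,
      forall x u, K x u -> exists2 v, F x v & anchor u = dmap i v,
      forall U e X, open U -> flat_lift U e -> vf_in_F U X ->
        vf_in_F U (lie (fun y => anchor (e y)) X)
    & forall U e1 e2, open U -> flat_lift U e1 -> flat_lift U e2 ->
        flat_lift U (br e1 e2)].

Context {B : manifold R}.
Variable p : N -> B.

Definition simple_by : Prop :=
  [/\ smooth_map p, forall y, exists x, p x = y,
      forall x (w : tangent B (p x)), exists v : tangent N x, dmap p v = w,
      forall y, connected (p @^-1` [set y])
    & forall x v, F x v <-> dmap p v = 0].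

Definition psharp {A : vbundle B} (Phi : forall x, A (p x) -> Q x)
    (s : sect A) : sect Q := fun x => Phi x (s (p x)).

(* nabla has trivial holonomy with quotient [A]: [Phi] is an isomorphism      *)
(* p^*A ~ Equot for which p^sharp identifies the sections of A over V with    *)
(* the flat sections of Equot over p^-1(V).  (Injectivity of p^sharp is       *)
(* automatic, p being onto.)                                                  *)
Record trivial_holonomy (A : vbundle B) (Phi : forall x, A (p x) -> Q x) :
    Prop := TrivialHolonomy {
  th_linear : forall x, linear (@Phi x);
  th_bij : forall x, bijective (@Phi x);
  th_smooth : forall x (s : sect (pullback p A)),
    ssmooth_at x s <-> @ssmooth_at R N Q x (fun y => Phi y (s y));
  th_flat : forall V s, open V -> smooth_on V s ->
    flat_on (p @^-1` V) (psharp Phi s);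
  th_onto : forall V q, open V -> flat_on (p @^-1` V) q ->
    exists2 s, smooth_on V s
      & forall x, V (p x) -> q x = psharp Phi s x }.

(* The Courant algebroid structure of [A] is the one obtained by reduction.   *)
(* The bracket is computed with lifts over arbitrary open sets U of M.        *)
Record is_reduced (A : courant B) (Phi : forall x, A (p x) -> Q x) : Prop :=
  IsReduced {
  red_met : forall x (a b : A (p x)), met a b = cmet D (Phi x a) (Phi x b);
  red_anchor : forall x (a : A (p x)) u (v : tangent N x),
    perp K x u -> pr u = Phi x a -> anchor u = dmap i v ->
    anchor a = dmap p v;
  red_br : forall U V e1 e2 (a1 a2 : sect A),
    open U -> open V -> (forall x, U (i x) -> V (p x)) ->
    flat_lift U e1 -> flat_lift U e2 -> smooth_on V a1 -> smooth_on V a2 ->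
    (forall x, U (i x) -> pr (e1 (i x)) = psharp Phi a1 x) ->
    (forall x, U (i x) -> pr (e2 (i x)) = psharp Phi a2 x) ->
    forall x, U (i x) -> psharp Phi (br a1 a2) x = pr (br e1 e2 (i x)) }.

Variable J : forall x, E x -> E x.

Definition preserves_flat_lifts : Prop :=
  forall U e, open U -> flat_lift U e -> flat_lift U (fun y => J (e y)).

(* J K <= K and nabla Jquot = 0, where [Jq] is the induced map Jquot. *)
Definition preserves_K_and_flat : Prop :=
  (forall x u, K x u -> K x (J u)) /\
  exists2 Jq : forall x, Q x -> Q x,
    (forall x u, perp K x u -> perp K x (J u) /\ Jq x (pr u) = pr (J u))
    & forall (V : set N) (Z : sect (TM N)) (q : sect Q),
        open V -> smooth_on V Z -> (forall x, V x -> F x (Z x)) ->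
        smooth_on V q ->
        forall x, V x ->
          cnabla D (Z x) (fun y => Jq y (q y)) = Jq x (cnabla D (Z x) q).

(* p^sharp (Jr a) = [J e] whenever e is in K^perp and [e] = p^sharp a. *)
Definition induces {A : vbundle B} (Phi : forall x, A (p x) -> Q x)
    (Jr : forall y, A y -> A y) : Prop :=
  forall x (a : A (p x)) u, perp K x u -> pr u = Phi x a ->
    perp K x (J u) /\ Phi x (Jr (p x) a) = pr (J u).

End Reduction.

(* Main.v *)
(* Flat lifts span K^perp pointwise, since the sections p^# s are flat and
   can be prescribed at a point.  So (a) makes J preserve K^perp, hence by
   skewness also K = (K^perp)^perp; every section of Equot is locally a
   combination of flat ones, and the Leibniz rule turns preservation of flat
   sections into nabla Jquot = 0.  Conversely, (b) makes J preserve flat lifts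
   directly.  Jquot maps p^# s to a flat section, that is to some p^# s', so
   it is constant along the fibres of p and descends to Jred; the algebraic
   identities of J, the torsion included, are pushed forward along local flat
   lifts. *)
Require Import Defs.
From mathcomp Require Import all_boot all_order all_algebra.
From mathcomp Require Import all_classical all_reals all_analysis.
Set Implicit Arguments.
Unset Strict Implicit.
Unset Printing Implicit Defensive.
Import Order.TTheory GRing.Theory Num.Theory numFieldNormedType.Exports.
Local Open Scope classical_set_scope.
Local Open Scope ring_scope.

(** * Neighbourhoods and germs *)

Lemma near_open (T : topologicalType) (U : set T) x (P : T -> Prop) :
  open U -> U x -> (forall y, U y -> P y) -> \forall y \near x, P y.
Proof. by move=> oU Ux UP; apply: (filterS UP); apply: open_nbhs_nbhs. Qed.

Lemma near_ex_open (T : topologicalType) x (P : T -> Prop) :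
  (\forall y \near x, P y) -> exists U, [/\ open U, U x & forall y, U y -> P y].
Proof.
by rewrite -[X in X -> _]/(nbhs x P) nbhsE => -[U [oU Ux] UP]; exists U.
Qed.

Lemma near_eq_continuous (T U : topologicalType) (f g : T -> U) x :
  (\forall y \near x, f y = g y) ->
  {for x, continuous f} -> {for x, continuous g}.
Proof.
move=> fg cf; change (g @ x --> g x); rewrite -(nbhs_singleton fg).
apply: cvg_trans cf; apply: near_eq_cvg.
by apply: filterS fg => y ->.
Qed.

(** * Functions of class C^k *)

Section CkTheory.
Context {R : realType}.

Lemma CkS n k (U : set 'rV[R]_n) f :
  Ck k.+1 U f <-> (forall a, U a -> {for a, continuous f}) /\
    forall j : 'I_n, (forall a, U a -> derivable f a 'e_j) /\
                     Ck k U (fun a => 'D_('e_j) f a).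
Proof. by []. Qed.

(** Openness of [U] makes [f] and [g] agree near each point of [U], so their partial derivatives
    agree on [U] as well. *)
Lemma Ck_eq n k (U : set 'rV[R]_n) f g : open U ->
  (forall a, U a -> f a = g a) -> Ck k U f -> Ck k U g.
Proof.
move=> oU; elim: k f g => [|k IHk] f g fg [cf df];
  have nfg a : U a -> \forall b \near a, f b = g b
    by move=> Ua; exact: near_open oU Ua fg.
  by split=> // a Ua; exact: near_eq_continuous (nfg _ Ua) (cf _ Ua).
split=> [a Ua|j]; first exact: near_eq_continuous (nfg _ Ua) (cf _ Ua).
have [dj Cj] := df j; split=> [a Ua|].
  exact: near_eq_derivable (nfg _ Ua) (dj _ Ua).
by apply: IHk Cj => a Ua; exact: near_eq_derive (nfg _ Ua).
Qed.

Lemma CkW n k (U : set 'rV[R]_n) f : Ck k.+1 U f -> Ck k U f.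
Proof.
elim: k f => [|k IHk] f /CkS[cf df]; first by split.
by apply/CkS; split=> // j; have [dj /IHk Cj] := df j.
Qed.

Lemma Ck_subset n k (U V : set 'rV[R]_n) f : V `<=` U -> Ck k U f -> Ck k V f.
Proof.
move=> VU; elim: k f => [|k IHk] f [cf df]; first by split=> // a /VU/cf.
split=> [a /VU/cf//|j]; have [dj Cj] := df j.
by split=> [a /VU/dj//|]; apply: IHk.
Qed.

Lemma Ck_cst n k (U : set 'rV[R]_n) c : Ck k U (fun=> c).
Proof.
elim: k c => [|k IHk] c; first by split=> // a _; exact: cst_continuous.
split=> [a _|j]; first exact: cst_continuous.
split=> [a _|]; first exact: derivable_cst.
by under eq_fun do rewrite (derive_cst c); exact: IHk.
Qed.

Lemma CkD n k (U : set 'rV[R]_n) f g : open U ->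
  Ck k U f -> Ck k U g -> Ck k U (fun a => f a + g a).
Proof.
move=> oU; elim: k f g => [|k IHk] f g [cf df] [cg dg].
  by split=> // a Ua; exact: cvgD (cf _ Ua) (cg _ Ua).
split=> [a Ua|j]; first exact: cvgD (cf _ Ua) (cg _ Ua).
have [[dfj Cf] [dgj Cg]] := (df j, dg j).
split=> [a Ua|]; first exact: derivableD (dfj _ Ua) (dgj _ Ua).
apply: (Ck_eq oU _ (IHk _ _ Cf Cg)) => a Ua.
by rewrite -deriveD; [|exact: dfj|exact: dgj].
Qed.

Lemma CkM n k (U : set 'rV[R]_n) f g : open U ->
  Ck k U f -> Ck k U g -> Ck k U (fun a => f a * g a).
Proof.
move=> oU; elim: k f g => [|k IHk] f g Cf Cg.
  case: Cf Cg => cf _ [cg _]; split=> // a Ua.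
  exact: cvgM (cf _ Ua) (cg _ Ua).
move: (Cf) (Cg) => [cf df] [cg dg].
split=> [a Ua|j]; first exact: cvgM (cf _ Ua) (cg _ Ua).
have [[dfj Cfj] [dgj Cgj]] := (df j, dg j).
split=> [a Ua|]; first exact: derivableM (dfj _ Ua) (dgj _ Ua).
(* The Leibniz rule multiplies [f] by a derivative of [g] that is only of class C^k, and conversely,
   so [f] and [g] are first lowered from class k+1 to class k. *)
have C1 := IHk _ _ (CkW Cf) Cgj; have C2 := IHk _ _ (CkW Cg) Cfj.
apply: (Ck_eq oU _ (CkD oU C1 C2)) => a Ua.
by rewrite -[LHS](deriveM (dfj _ Ua) (dgj _ Ua)).
Qed.

(* A coordinate projection maps each basis vector to a basis vector or to 0,  *)
(* so the partial derivatives of g o L are again of the form h o L.           *)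
Lemma Ck_lsubmx n m k (U : set 'rV[R]_n) g : Ck k U g ->
  Ck k (lsubmx @^-1` U) (fun a : 'rV[R]_(n + m) => g (lsubmx a)).
Proof.
have cl a h : U (lsubmx a) -> (forall b, U b -> {for b, continuous h}) ->
    {for a, continuous (fun b : 'rV[R]_(n + m) => h (lsubmx b) : R)}.
  move=> Ua ch.
  have cs := @continuous_lsubmx _ _ _ _ a.
  exact: (@continuous_comp _ _ _ lsubmx) cs (ch _ Ua).
(* Both [derivable] and [derive] are defined by this difference quotient, so one identity settles
   existence and value of the derivatives. *)
have shiftE (h : 'rV[R]_n -> R) (a v : 'rV[R]_(n + m)) :
    (fun t : R => t^-1 *:
      (((fun b : 'rV_(n + m) => h (lsubmx b)) \o shift a) (t *: v) -
       h (lsubmx a))) =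
    (fun t : R => t^-1 *:
      ((h \o shift (lsubmx a)) (t *: lsubmx v) - h (lsubmx a))).
  apply/funext => t /=; congr (_ *: (h _ - _)).
  by apply/rowP => l; rewrite !mxE.
elim: k g => [|k IHk] g [cg dg].
  by split=> // a Ua; exact: cl cg.
split=> [a Ua|j]; first exact: cl cg.
have [[j' ej]|e0] : (exists j', lsubmx ('e_j : 'rV[R]_(n + m)) = 'e_j')
    \/ lsubmx ('e_j : 'rV[R]_(n + m)) = 0.
  case: (splitP j) => j' jE.
    left; exists j'; apply/rowP => l; rewrite !mxE !eqxx /=; congr (_%:R).
    congr nat_of_bool; apply/eqP/eqP => [lj|->]; apply/val_inj => //=.
    by rewrite -jE -lj.
  right; apply/rowP => l; rewrite !mxE eqxx /=.
  rewrite [lshift _ _ == _](_ : _ = false)//; apply/eqP => /(congr1 val) /=.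
  by rewrite jE => lE; have := ltn_ord l; rewrite lE ltnNge leq_addr.
- have [dj Cj] := dg j'; split=> [a Ua|].
    by rewrite /derivable shiftE ej; exact: dj.
  rewrite [X in Ck k _ X](_ : _ = (fun a => 'D_('e_j') g (lsubmx a))).
    exact: IHk Cj.
  by apply/funext => a; rewrite /derive shiftE ej.
- split=> [a Ua|]; first by rewrite /derivable shiftE e0; exact: derivable0.
  rewrite [X in Ck k _ X](_ : _ = fun=> 0); first exact: Ck_cst.
  by apply/funext => a; rewrite /derive shiftE e0; exact: derive0.
Qed.

End CkTheory.

(** * Smooth functions and sections *)

Section SmoothRTheory.
Context {R : realType}.

Lemma smoothR_cst n (a : 'rV[R]_n) c : smoothR a (fun=> c).
Proof. by exists setT; split=> // [|k]; [exact: openT|exact: Ck_cst]. Qed.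

Lemma smoothRD n (a : 'rV[R]_n) f g :
  smoothR a f -> smoothR a g -> smoothR a (fun b => f b + g b).
Proof.
move=> [U [oU Ua sf]] [V [oV Va sg]]; exists (U `&` V).
have oUV := openI oU oV; split=> // k.
by apply: CkD => //; [apply: Ck_subset (sf k)|apply: Ck_subset (sg k)] => ? [].
Qed.

Lemma smoothRM n (a : 'rV[R]_n) f g :
  smoothR a f -> smoothR a g -> smoothR a (fun b => f b * g b).
Proof.
move=> [U [oU Ua sf]] [V [oV Va sg]]; exists (U `&` V).
have oUV := openI oU oV; split=> // k.
by apply: CkM => //; [apply: Ck_subset (sf k)|apply: Ck_subset (sg k)] => ? [].
Qed.

Lemma smoothR_near n (a : 'rV[R]_n) f :
  smoothR a f -> \forall b \near a, smoothR b f.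
Proof.
by move=> [U [oU Ua sf]]; apply: (near_open oU Ua) => b Ub; exists U.
Qed.

Lemma smoothR_lsubmx n m (a : 'rV[R]_(n + m)) g :
  smoothR (lsubmx a) g -> smoothR a (fun b => g (lsubmx b)).
Proof.
move=> [U [oU Ua sg]]; exists (lsubmx @^-1` U); split=> // [|k].
  by apply: open_comp => // b _; exact: continuous_lsubmx.
exact: Ck_lsubmx.
Qed.

End SmoothRTheory.

Section SmoothAt.
Context {R : realType} {M : manifold R}.
Implicit Types (x : M) (f g : M -> R).

Lemma manifold_chart x : exists n U (phi : M -> 'rV[R]_n),
  U x /\ is_chart smooth_at U phi.
Proof. by case: M x. Qed.

Lemma smooth_at_eq x f g :
  (\forall y \near x, f y = g y) -> smooth_at x f -> smooth_at x g.
Proof.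
have [n [U [phi [Ux [_ _ _ _ sm]]]]] := manifold_chart x.
move=> fg /(sm _ _ Ux)[h sh fh]; apply/(sm _ _ Ux); exists h => //.
by apply: filterS2 fg fh => y ->.
Qed.

(** One function [h] represents [f] in the chart on a whole neighbourhood of [x] and is smooth near
    [phi x], so the same [h] serves at the nearby points. *)
Lemma smooth_at_near x f : smooth_at x f -> \forall y \near x, smooth_at y f.
Proof.
have [n [U [phi [Ux [oU _ cphi _ sm]]]]] := manifold_chart x.
move=> /(sm _ _ Ux)[h sh /near_join fh].
have nU : nbhs x U by exact: open_nbhs_nbhs.
have nh : \forall y \near x, smoothR (phi y) h := cphi x Ux _ (smoothR_near sh).
apply: filterS3 nU nh fh => y Uy shy fhy.
by apply/(sm _ _ Uy); exists h.
Qed.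

Lemma smooth_at_cst x c : smooth_at x (fun=> c).
Proof.
have [n [U [phi [Ux [_ _ _ _ sm]]]]] := manifold_chart x.
by apply/(sm _ _ Ux); exists (fun=> c); [exact: smoothR_cst|exact: nearW].
Qed.

Lemma smooth_atD x f g :
  smooth_at x f -> smooth_at x g -> smooth_at x (fun y => f y + g y).
Proof.
have [n [U [phi [Ux [_ _ _ _ sm]]]]] := manifold_chart x.
move=> /(sm _ _ Ux)[f' sf ff'] /(sm _ _ Ux)[g' sg gg'].
apply/(sm _ _ Ux); exists (fun b => f' b + g' b); first exact: smoothRD.
by apply: filterS2 ff' gg' => y -> ->.
Qed.

Lemma smooth_atM x f g :
  smooth_at x f -> smooth_at x g -> smooth_at x (fun y => f y * g y).
Proof.
have [n [U [phi [Ux [_ _ _ _ sm]]]]] := manifold_chart x.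
move=> /(sm _ _ Ux)[f' sf ff'] /(sm _ _ Ux)[g' sg gg'].
apply/(sm _ _ Ux); exists (fun b => f' b * g' b); first exact: smoothRM.
by apply: filterS2 ff' gg' => y -> ->.
Qed.

End SmoothAt.

Section VBundle.
Context {R : realType} {M : manifold R} (A : vbundle M).
Implicit Types (x : M) (s t : sect A).

Lemma local_frame x : exists r (b : 'I_r -> sect A), \forall y \near x,
  is_basis (fun j => b j y) setT /\
  forall s, ssmooth_at y s <->
    exists2 c : 'I_r -> M -> R, forall j, smooth_at y (c j)
      & \forall z \near y, s z = \sum_j c j z *: b j z.
Proof. by case: A x. Qed.

Lemma ssmooth_at_eq x s t :
  (\forall y \near x, s y = t y) -> ssmooth_at x s -> ssmooth_at x t.
Proof.
have [r [b /nbhs_singleton[_ sm]]] := local_frame x.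
move=> st /sm[c sc sE]; apply/sm; exists c => //.
by apply: filterS2 st sE => y ->.
Qed.

Lemma ssmooth_at_near x s : ssmooth_at x s -> \forall y \near x, ssmooth_at y s.
Proof.
have [r [b H]] := local_frame x.
have [_ sm] := nbhs_singleton H; move=> /sm[c sc /near_join sE].
have nc : \forall y \near x, forall j, smooth_at y (c j).
  by apply: filter_forall => j; exact: smooth_at_near.
apply: filterS3 H nc sE => y [_ smy] scy sEy.
by apply/smy; exists c.
Qed.

Lemma ssmooth_at0 x : ssmooth_at x (fun y => 0 : A y).
Proof.
have [r [b /nbhs_singleton[_ sm]]] := local_frame x.
apply/sm; exists (fun _ _ => 0) => [j|]; first exact: smooth_at_cst.
by apply: nearW => y; rewrite big1 // => j _; rewrite scale0r.
Qed.

Lemma ssmooth_atD x s t :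
  ssmooth_at x s -> ssmooth_at x t -> ssmooth_at x (fun y => s y + t y).
Proof.
have [r [b /nbhs_singleton[_ sm]]] := local_frame x.
move=> /sm[c sc sE] /sm[d sd tE]; apply/sm.
exists (fun j y => c j y + d j y) => [j|]; first exact: smooth_atD.
apply: filterS2 sE tE => y -> ->; rewrite -big_split /=.
by apply: eq_bigr => j _; rewrite scalerDl.
Qed.

Lemma ssmooth_atZ x f s :
  smooth_at x f -> ssmooth_at x s -> ssmooth_at x (fun y => f y *: s y).
Proof.
have [r [b /nbhs_singleton[_ sm]]] := local_frame x.
move=> sf /sm[c sc sE]; apply/sm.
exists (fun j y => f y * c j y) => [j|]; first exact: smooth_atM.
apply: filterS sE => y ->; rewrite scaler_sumr.
by apply: eq_bigr => j _; rewrite scalerA.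
Qed.

Lemma ssmooth_at_lin x r (c : 'I_r -> M -> R) (s : 'I_r -> sect A) :
  (forall j, smooth_at x (c j)) -> (forall j, ssmooth_at x (s j)) ->
  ssmooth_at x (fun y => \sum_j c j y *: s j y).
Proof.
move=> sc ss; elim: (index_enum _) => [|j l IHl].
  by apply: ssmooth_at_eq (ssmooth_at0 x); apply: nearW => y; rewrite big_nil.
apply: ssmooth_at_eq (ssmooth_atD (ssmooth_atZ (sc j) (ss j)) IHl).
by apply: nearW => y; rewrite big_cons.
Qed.

(** The coefficients of [v] in a local frame are kept constant. *)
Lemma ssmooth_at_ext x (v : A x) : exists2 s : sect A, ssmooth_at x s & s x = v.
Proof.
have [r [b H]] := local_frame x.
have [[_ /(_ v)[/(_ I)[c vE] _]] _] := nbhs_singleton H.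
exists (fun y => \sum_j c j *: b j y) => //.
have [_ sm] := nbhs_singleton H; apply/sm.
exists (fun j _ => c j) => [j|]; first exact: smooth_at_cst.
exact: nearW.
Qed.

End VBundle.

Section TangentLin.
Context {R : realType} {M : manifold R}.

Lemma tangent_sumE (x : M) r (c : 'I_r -> R) (v : 'I_r -> tangent M x) f :
  (\sum_j c j *: v j) f = \sum_j c j * v j f.
Proof.
elim: (index_enum _) => [|j l IHl]; first by rewrite !big_nil.
by rewrite !big_cons -IHl.
Qed.

(** [TM M] is declared as a [vfamily], which [ssmooth_at_lin] does not cover. Constant coefficients
    are enough for extending a vector of F to a section of F. *)
Lemma TM_smooth_lin (x : M) r (c : 'I_r -> R) (X : 'I_r -> sect (TM M)) :
  (forall j, ssmooth_at x (X j)) ->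
  @ssmooth_at R M (TM M) x (fun y => \sum_j c j *: X j y).
Proof.
move=> sX f sf.
suff : smooth_at x (fun y => \sum_j c j * (X j y : tangent M y) f).
  by apply: smooth_at_eq; apply: nearW => y; rewrite tangent_sumE.
elim: (index_enum _) => [|j l IHl].
  apply: smooth_at_eq (smooth_at_cst x 0).
  by apply: nearW => y; rewrite big_nil.
have scX := smooth_atM (smooth_at_cst x (c j)) (sX j f sf).
apply: smooth_at_eq (smooth_atD scX IHl).
by apply: nearW => y; rewrite big_cons.
Qed.

End TangentLin.

(** * Embedded submanifolds *)

Lemma continuous_row_mx0 {R : numFieldType} m {n1 n2} :
  continuous (fun u : 'M[R]_(m, n1) => row_mx u (0 : 'M[R]_(m, n2))).
Proof.
move=> u A /nbhs_ballP[e /= e0 eA].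
apply/nbhs_ballP; exists e => //= v [_ uv]; apply: eA; split => // i j.
by rewrite !mxE; case: splitP => k _ //; rewrite ?mxE; exact: ballxx.
Qed.

Section Submanifold.
Context {R : realType} {M N : manifold R} (i : N -> M).
Hypothesis subi : is_submanifold i.

(** In a slice chart [phi o i] is (psi, 0) with psi a chart of N, hence continuous. As [phi] is open
    and injective on [U], it can be cancelled. *)
Lemma submanifold_continuous : continuous i.
Proof.
have [_ sub] := subi.
move=> x W nW.
have [n [k [U [phi [Ux [oU iU cU opU _] slice [oV _ cV _ _]]]]]] := sub x.
set psi := fun y => lsubmx (phi (i y)) in cV *.
have phiE y : U (i y) -> phi (i y) = row_mx (psi y) 0.
  by move=> Uy; rewrite -[LHS]hsubmxK ((slice _ Uy).1 _)//; exists y.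
have oW' : open (phi @` (W° `&` U)).
  by apply: opU; [apply: openI => //; exact: open_interior|apply: subIsetr].
have cf : {for x, continuous (fun y => row_mx (psi y) (0 : 'rV[R]_k))}.
  have cr := @continuous_row_mx0 R 1 n k (psi x).
  exact: (@continuous_comp _ _ _ psi) (cV x Ux) cr.
have W'x : (phi @` (W° `&` U)) (row_mx (psi x) 0).
  by rewrite -phiE//; exists (i x).
have nU : nbhs x (i @^-1` U) by exact: open_nbhs_nbhs.
have := cf _ (open_nbhs_nbhs (conj oW' W'x)).
apply: filterS2 nU => y Uy [w [Ww Uw]]; rewrite -phiE// => phiw.
change (W (i y)); rewrite -(iU _ _ _ _ phiw) ?inE//.
exact: interior_subset.
Qed.

(** N carries the subspace topology: the chart psi of N is open, so the image of [W] under psi is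
    open in R^n, and its preimage under the first n coordinates of [phi] is a neighbourhood in M
    that meets N only inside [W]. *)
Lemma submanifold_nbhs x (W : set N) : nbhs x W ->
  exists U : set M, [/\ open U, U (i x) & forall y, U (i y) -> W y].
Proof.
have [_ sub] := subi => nW.
have [n [k [U [phi [Ux [oU iU cU opU _] slice [oV iV cV opV _]]]]]] := sub x.
set psi := fun y => lsubmx (phi (i y)) in iV cV opV *.
have oW' : open (psi @` (W° `&` i @^-1` U)).
  by apply: opV; [apply: openI => //; exact: open_interior|apply: subIsetr].
have ox : open_nbhs (lsubmx (phi (i x))) (psi @` (W° `&` i @^-1` U)).
  by split => //; exists x.
have : nbhs (i x)
    ((fun z => lsubmx (phi z)) @^-1` (psi @` (W° `&` i @^-1` U)) `&` U).
  apply: filterI; last exact: open_nbhs_nbhs.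
  have cl : {for i x, continuous (fun z => lsubmx (phi z))}.
    have cs := @continuous_lsubmx R 1 n k (phi (i x)).
    exact: (@continuous_comp _ _ _ phi) (cU _ Ux) cs.
  exact: cl _ (open_nbhs_nbhs ox).
rewrite nbhsE => -[U' [oU' U'x] U'U]; exists U'; split=> // y /U'U[].
move=> [w [Ww Uw] psiw] Uy.
by rewrite -(iV _ _ _ _ psiw) ?inE//; exact: interior_subset.
Qed.

(** In a slice chart the function is extended to be constant in the normal coordinates. *)
Lemma submanifold_smooth_ext x (c : N -> R) : smooth_at x c ->
  exists2 C : M -> R, smooth_at (i x) C & \forall y \near x, c y = C (i y).
Proof.
have [_ sub] := subi.
have [n [k [U [phi [Ux [_ _ _ _ smU] _ [_ _ _ _ smV]]]]]] := sub x.
move=> /(smV _ _ Ux)[g sg cE].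
exists (fun z => g (lsubmx (phi z))) => //.
apply/(smU _ _ Ux); exists (fun a => g (lsubmx a)); last exact: nearW.
exact: smoothR_lsubmx.
Qed.

(** The sections [b j] in the definition of [pullback] already live on M, so only the coefficients
    have to be extended. *)
Lemma pullback_ssmooth_ext (E : vbundle M) x (e : sect (pullback i E)) :
  ssmooth_at x e -> exists2 e' : sect E, ssmooth_at (i x) e'
    & \forall y \near x, e y = e' (i y).
Proof.
move=> [r [c [b [sc sb eE]]]].
have /choice[C CP] : forall j, exists C : M -> R, smooth_at (i x) C /\
    \forall y \near x, c j y = C (i y).
  by move=> j; have [C sC cE] := submanifold_smooth_ext (sc j); exists C.
exists (fun z => \sum_j C j z *: b j z).
  by apply: ssmooth_at_lin => // j; have [] := CP j.
have nC : \forall y \near x, forall j, c j y = C j (i y).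
  by apply: filter_forall => j; have [] := CP j.
apply: filterS2 eE nC => y -> cE.
by apply: eq_bigr => j _; rewrite cE.
Qed.

End Submanifold.

Lemma ssmooth_at_pullback {R : realType} {M N : manifold R} (i : N -> M)
    (E : vbundle M) x (e : sect E) :
  ssmooth_at (i x) e -> @ssmooth_at R N (pullback i E) x (fun y => e (i y)).
Proof.
move=> se; exists 1%N, (fun _ _ => 1), (fun _ => e); split=> // [j|].
  exact: smooth_at_cst.
by apply: nearW => y; rewrite big_ord1 scale1r.
Qed.

(** * Flat sections and their lifts *)

Section LinearFun.
Context {R : pzRingType} {V W : lmodType R} {f : V -> W}.
Hypothesis lf : linear f.

Lemma linear_fun0 : f 0 = 0.
Proof.
have := lf 1 0 0; rewrite !scale1r addr0 => /eqP.
by rewrite -[X in X == _]addr0 (inj_eq (addrI _)) => /eqP.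
Qed.

Lemma linear_funZ a u : f (a *: u) = a *: f u.
Proof. by have := lf a u 0; rewrite linear_fun0 !addr0. Qed.

Lemma linear_funD u v : f (u + v) = f u + f v.
Proof. by have := lf 1 u v; rewrite !scale1r. Qed.

Lemma linear_funN u : f (- u) = - f u.
Proof. by rewrite -scaleN1r linear_funZ scaleN1r. Qed.

Lemma linear_fun_sum r (c : 'I_r -> R) (v : 'I_r -> V) :
  f (\sum_j c j *: v j) = \sum_j c j *: f (v j).
Proof.
elim: (index_enum _) => [|j l IHl]; first by rewrite !big_nil linear_fun0.
by rewrite !big_cons lf IHl.
Qed.

End LinearFun.

Section Metric.
Context {R : realType} {M : manifold R} {E : courant M} {x : M}.
Implicit Types u v w : E x.

Lemma met_sym u v : met u v = met v u.
Proof. by case: E x u v. Qed.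

Lemma met_linear a u v w : met (a *: u + v) w = a * met u w + met v w.
Proof. by case: E x u v w. Qed.

Lemma met_nondegenerate u : (forall v, met u v = 0) -> u = 0.
Proof. by case: E x u. Qed.

End Metric.

Section Data.
Context {R : realType} {M : manifold R} {E : courant M}.
Variable D : coisotropic_data E.
Local Notation N := (cN D).
Local Notation i := (cincl D).
Local Notation K := (cK D).
Local Notation F := (cF D).
Local Notation Q := (cQ D).
Local Notation pr := (cpr D).

Let quot := c_quot D.
Let conn := c_nabla D.
Let ci : continuous i := submanifold_continuous (c_sub D).

Lemma perp_linear x a u v :
  perp K x u -> perp K x v -> perp K x (a *: u + v).
Proof. by move=> Ku Kv w Kw; rewrite met_linear Ku// Kv// mulr0 addr0. Qed.

Lemma perp0 x : perp K x 0.
Proof.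
move=> w Kw; have := met_linear 1 (0 : E (i x)) 0 w.
rewrite scale1r addr0 mul1r => /eqP.
by rewrite -[X in X == _]addr0 (inj_eq (addrI _)) => /eqP/esym.
Qed.

Lemma perpB x u v : perp K x u -> perp K x v -> perp K x (u - v).
Proof. by move=> Ku Kv; rewrite -scaleN1r addrC; exact: perp_linear. Qed.

Lemma K_perp x u : K x u -> perp K x u.
Proof. by move=> Ku v Kv; exact: (c_isotropic Ku Kv). Qed.

Lemma prB x u v : perp K x u -> perp K x v -> pr (u - v) = pr u - pr v.
Proof.
by move=> Ku Kv; rewrite addrC -scaleN1r (q_linear quot)// scaleN1r addrC.
Qed.

Lemma pr0 x : cpr D (0 : E (i x)) = 0.
Proof. by have := prB (@perp0 x) (@perp0 x); rewrite !subrr. Qed.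

Lemma pr_eqP x u v : perp K x u -> perp K x v -> pr u = pr v <-> K x (u - v).
Proof.
move=> Ku Kv; rewrite -(q_ker quot (perpB Ku Kv)) prB//.
by split=> [->|/eqP]; rewrite ?subrr// subr_eq0 => /eqP.
Qed.

Lemma flat_on_eq (V : set N) q q' : open V -> (forall x, V x -> q x = q' x) ->
  flat_on V q -> flat_on V q'.
Proof.
move=> oV qq' [sq fq].
have nq x : V x -> \forall y \near x, q y = q' y.
  by move=> Vx; exact: near_open oV Vx qq'.
split=> [x Vx|x v Vx Fv]; first exact: ssmooth_at_eq (nq x Vx) (sq x Vx).
by rewrite -(n_local conn Fv (sq x Vx) (nq x Vx)) fq.
Qed.

Lemma flat_onS (V W : set N) q : W `<=` V -> flat_on V q -> flat_on W q.
Proof. by move=> WV [sq fq]; split=> [x /WV/sq//|x v /WV]; exact: fq. Qed.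

Lemma flat_liftS (U W : set M) e :
  W `<=` U -> flat_lift D U e -> flat_lift D W e.
Proof.
move=> WU [se Ke fe]; split=> [x /WU/se//|x /WU/Ke//|].
by apply: flat_onS fe => x /WU.
Qed.

Lemma flat_on0 (V : set N) : flat_on V (fun=> 0).
Proof.
split=> [x _|x v _ Fv]; first exact: ssmooth_at0.
(* The zero section is read as 0 times itself, and the Leibniz rule for this product gives 0. *)
have := n_leibniz conn Fv (smooth_at_cst x 0) (ssmooth_at0 Q x).
rewrite scaler0 scale0r addr0 => <-.
apply: (n_local conn Fv (ssmooth_at0 Q x)).
by apply: nearW => y; rewrite scaler0.
Qed.

Lemma nabla_flat_comb x v r (c : 'I_r -> N -> R) (q : 'I_r -> sect Q) :
  F x v -> (forall j, smooth_at x (c j)) -> (forall j, ssmooth_at x (q j)) ->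
  (forall j, cnabla D v (q j) = 0) ->
  cnabla D v (fun y => \sum_j c j y *: q j y) =
    \sum_j (v : tangent N x) (c j) *: q j x.
Proof.
move=> Fv sc sq fq.
(* Smoothness of the partial sums is carried through the induction because [n_add] asks for it. *)
suff H : forall l : seq 'I_r,
  ssmooth_at x (fun y => \sum_(j <- l) c j y *: q j y) /\
  cnabla D v (fun y => \sum_(j <- l) c j y *: q j y) =
    \sum_(j <- l) (v : tangent N x) (c j) *: q j x by exact: (H _).2.
elim=> [|j l [sl nl]].
  rewrite big_nil [X in ssmooth_at _ X /\ cnabla _ _ X = _](_ : _ = fun=> 0).
    by have [s0 n0] := flat_on0 setT; split; [exact: s0|exact: n0].
  by apply: functional_extensionality_dep => y; rewrite big_nil.
rewrite [X in ssmooth_at _ X /\ cnabla _ _ X = _](_ : _ =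
    fun y => c j y *: q j y + \sum_(j <- l) c j y *: q j y); last first.
  by apply: functional_extensionality_dep => y; rewrite big_cons.
have sj := ssmooth_atZ (sc j) (sq j).
split; first exact: ssmooth_atD.
by rewrite (n_add conn)// nl (n_leibniz conn)// fq scaler0 addr0 big_cons.
Qed.

(** [q] lifts along N to a section of K^perp, which extends to M near [i x]. Two shrinkings follow:
    one keeps the extension smooth, the other makes it lift [q] at all points of N in the open
    set. *)
Lemma flat_lift_exists x (V : set N) q : open V -> V x -> flat_on V q ->
  exists U e, [/\ open U, U (i x), forall y, U (i y) -> V y,
    flat_lift D U e & forall y, U (i y) -> pr (e (i y)) = q y].
Proof.
move=> oV Vx fq; have [sq _] := fq.
have /(q_smooth quot)[e0 se0 e0q] := sq x Vx.
have [e se ee0] := pullback_ssmooth_ext (c_sub D) se0.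
have nV : nbhs x V by exact: open_nbhs_nbhs.
have n1 : \forall y \near x, V y /\ (perp K y (e (i y)) /\ q y = pr (e (i y))).
  by apply: filterS3 nV ee0 e0q => y Vy ->.
have [U1 [oU1 U1x U1P]] := submanifold_nbhs (c_sub D) n1.
have [U2 [oU2 U2x U2P]] := near_ex_open (ssmooth_at_near se).
have UP y : (U1 `&` U2) (i y) ->
    V y /\ (perp K y (e (i y)) /\ q y = pr (e (i y))).
  by move=> [/U1P].
have oU : open (U1 `&` U2) by exact: openI.
exists (U1 `&` U2), e; split=> //; first by move=> y /UP[].
- split=> [y [_ /U2P]|y /UP[_ []]|]//.
  apply: (@flat_on_eq _ q) => [|y /UP[_ []]//|]; last first.
    by apply: flat_onS fq => y /UP[].
  by apply: open_comp => // y _; exact: ci.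
- by move=> y /UP[_ []].
Qed.

(** A section with values in K along N projects to the zero section of Equot, which is flat. Such a
    section through [u] comes from a local frame of K with constant coefficients. *)
Lemma K_flat_lift x u : K x u -> exists U e,
  [/\ open U, U (i x), flat_lift D U e & e (i x) = u].
Proof.
move=> Ku; have [r [b bP]] := c_K x.
have [sb [_ /(_ u)[/(_ Ku)[c uE] _]]] := nbhs_singleton bP.
have /choice[B BP] : forall j, exists B : sect E, ssmooth_at (i x) B /\
    \forall y \near x, b j y = B (i y).
  move=> j; have [B sB bB] := pullback_ssmooth_ext (c_sub D) (sb j).
  by exists B.
have nB : \forall y \near x, forall j, b j y = B j (i y).
  by apply: filter_forall => j; have [] := BP j.
pose e : sect E := fun z => \sum_j c j *: B j z.
have se : ssmooth_at (i x) e.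
  by apply: (@ssmooth_at_lin _ _ _ _ _ (fun j _ => c j)) => j;
    [exact: smooth_at_cst|have [] := BP j].
have n1 : \forall y \near x, K y (e (i y)).
  apply: filterS2 bP nB => y [_ [_ /(_ (e (i y)))[_ KP]]] bB.
  by apply: KP; exists c; apply: eq_bigr => j _; rewrite bB.
have [U1 [oU1 U1x U1P]] := submanifold_nbhs (c_sub D) n1.
have [U2 [oU2 U2x U2P]] := near_ex_open (ssmooth_at_near se).
exists (U1 `&` U2), e; split=> //; [exact: openI| |].
- have oU : open (i @^-1` (U1 `&` U2)).
    by apply: open_comp => [y _|]; [exact: ci|exact: openI].
  split=> [y [_ /U2P]//|y [/U1P/K_perp]//|].
  apply: (flat_on_eq oU) (flat_on0 _) => y [/U1P Ky _].
  by apply/esym/(q_ker quot) => //; exact: K_perp.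
- rewrite uE; apply: eq_bigr => j _.
  by rewrite (nbhs_singleton nB).
Qed.

End Data.

(** * Reduction *)

(** This is the clause on Jquot in condition (b). Stability of K^perp belongs to it because [pr] is
    meaningful only there. *)
Definition quotient_map {R : realType} {M : manifold R} {E : courant M}
    (D : coisotropic_data E) (J : forall x, E x -> E x)
    (Jq : forall x, cQ D x -> cQ D x) : Prop :=
  forall x u, perp (cK D) x u ->
    perp (cK D) x (J _ u) /\ Jq x (cpr D u) = cpr D (J _ u).

(** * The induced endomorphism of K^perp/K, and the passage from (b) to (a) *)

Section Quotient.
Context {R : realType} {M : manifold R} {E : courant M}.
Context {D : coisotropic_data E} {J : forall x, E x -> E x}.
Local Notation N := (cN D).
Local Notation i := (cincl D).
Local Notation K := (cK D).
Local Notation F := (cF D).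
Local Notation Q := (cQ D).
Local Notation pr := (cpr D).

Let quot := c_quot D.
Let conn := c_nabla D.
Let ci : continuous i := submanifold_continuous (c_sub D).

Hypothesis gcJ : gen_complex J.
Context {Jq : forall x, Q x -> Q x}.
Hypothesis JqP : quotient_map J Jq.

Lemma quotient_map_linear x : linear (@Jq x).
Proof.
move=> a q q'.
have [[u Ku <-] [v Kv <-]] := (q_onto quot q, q_onto quot q').
rewrite -(q_linear quot)// (JqP (perp_linear a Ku Kv)).2 (gc_linear gcJ).
have [[KJu Ju] [KJv Jv]] := (JqP Ku, JqP Kv).
by rewrite (q_linear quot)// Ju Jv.
Qed.

(** Flatness is local: near each point [q] is the class of a flat lift [e], by (a) [J e] is again a
    flat lift, and its class is Jq q. *)
Lemma quotient_map_flat (V : set N) q : preserves_flat_lifts D J ->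
  open V -> flat_on V q -> flat_on V (fun x => Jq (q x)).
Proof.
move=> pJ oV fq.
suff H x : V x -> exists W, [/\ open W, W x & flat_on W (fun x => Jq (q x))].
  split=> [x /H[W [_ Wx [sW _]]]|x v /H[W [_ Wx [_ fW]]]]; first exact: sW.
  exact: fW.
move=> Vx; have [U [e [oU Ux UV le eq]]] := flat_lift_exists oV Vx fq.
have oW : open (i @^-1` U) by apply: open_comp => // y _; exact: ci.
exists (i @^-1` U); split=> //.
have [_ Ke _] := le; have [_ _ fJ] := pJ U e oU le.
apply: (flat_on_eq oW) fJ => y Uy.
by rewrite -(JqP (Ke y Uy)).2 eq.
Qed.

(** Flatness is tested on single vectors of F, whereas (b) speaks of vector fields in F; this passes
    from the former to the latter. *)
Lemma flat_subbundle_section x v : F x v ->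
  exists V (Z : sect (TM N)), [/\ open V, V x, smooth_on V Z,
    forall y, V y -> F y (Z y) & Z x = v].
Proof.
move=> Fv; have [r [b bP]] := c_F x.
have [_ [_ /(_ v)[/(_ Fv)[c vE] _]]] := nbhs_singleton bP.
have [V [oV Vx VP]] := near_ex_open bP.
exists V, (fun y => \sum_j c j *: b j y); split=> //.
- by move=> y /VP[sb _]; exact: TM_smooth_lin.
- by move=> y /VP[_ [_ /(_ (\sum_j c j *: b j y))[_]]]; apply; exists c.
Qed.

(** For a flat lift [e], the derivative of [J e] = Jquot [e] along F is Jquot applied to the
    derivative of [e], hence Jquot 0 = 0. *)
Lemma preserves_flat_of_K :
  preserves_K_and_flat D J -> preserves_flat_lifts D J.
Proof.
move=> [_ [Jq' Jq'P nJ]] U e oU [se Ke [sq fq]].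
have oV : open (i @^-1` U) by apply: open_comp => // y _; exact: ci.
have KJe x : U (i x) -> perp K x (J (e (i x))) by move=> /Ke/Jq'P[].
have sJe : @smooth_on R M E U (fun y => J (e y)).
  by move=> y Uy; have := gc_smooth gcJ (se y Uy).
have sprJ : @smooth_on R N Q (i @^-1` U) (fun x => pr (J (e (i x)))).
  move=> x Ux; apply/(q_smooth quot); exists (fun y => J (e (i y))).
    exact: (@ssmooth_at_pullback _ _ _ _ E _ (fun y => J (e y))) (sJe _ Ux).
  by apply: (near_open oV Ux) => y Uy; split=> //; exact: KJe.
split=> //; split=> // x v Ux Fv.
have [V [Z [oW Wx sZ FZ <-]]] := flat_subbundle_section Fv.
have nE : \forall y \near x, pr (J (e (i y))) = Jq' y (pr (e (i y))).
  by apply: (near_open oV Ux) => y /Ke/Jq'P[_ ->].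
rewrite (n_local conn (FZ _ Wx) (sprJ _ Ux) nE).
rewrite (nJ (V `&` i @^-1` U) Z (fun y => pr (e (i y))))//; first last.
- by move=> y [_ Uy]; exact: sq.
- by move=> y [/FZ].
- by move=> y [/sZ].
- exact: openI.
rewrite fq//; last exact: FZ.
(* Jquot 0 = 0 is read off at the lift 0 of 0, since J 0 = 0. *)
have [Jp0] := Jq'P x 0 (@perp0 _ _ _ D x).
by rewrite (linear_fun0 (@gc_linear _ _ _ _ gcJ (i x))) pr0.
Qed.

End Quotient.

(** * Passage from (a) to (b), through the quotient by p *)

Section Reduced.
Context {R : realType} {M : manifold R} {E : courant M}.
Context {D : coisotropic_data E} {J : forall x, E x -> E x}.
Local Notation N := (cN D).
Local Notation i := (cincl D).
Local Notation K := (cK D).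
Local Notation F := (cF D).
Local Notation Q := (cQ D).
Local Notation pr := (cpr D).
Context {B : manifold R} {p : N -> B} {Ered : courant B}.
Context {Phi : forall x, Ered (p x) -> Q x}.
Hypothesis redD : reducible D.
Hypothesis simp : simple_by p.
Hypothesis holP : trivial_holonomy Phi.
Hypothesis redP : is_reduced Phi.
Hypothesis gcJ : gen_complex J.

Let quot := c_quot D.
Let conn := c_nabla D.

Let cp : continuous p. Proof. by case: simp => -[]. Qed.

Let Phi_inj x : injective (@Phi x). Proof. exact: bij_inj (th_bij holP x). Qed.

Let Phi_onto x q : exists a, @Phi x a = q.
Proof. by case: (th_bij holP x) => g _ gK; exists (g q). Qed.

(** No dimension count is made. As K is isotropic, [u] lies in K^perp, and its class is orthogonal
    to all of Equot. The metric of Equot is that of [Ered] transported by [Phi], hence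
    non-degenerate, so the class vanishes. *)
Lemma perp_perp x u : (forall v, perp K x v -> met u v = 0) -> K x u.
Proof.
move=> Hu; have Ku : perp K x u by move=> v /K_perp/Hu.
apply/(q_ker quot Ku); have [a aE] := Phi_onto (pr u); rewrite -aE.
rewrite (_ : a = 0) ?(linear_fun0 (@th_linear _ _ _ _ _ _ _ _ holP x))//.
apply: met_nondegenerate => b; rewrite (red_met redP) aE.
have [v Kv <-] := q_onto quot (Phi b).
by rewrite (q_met quot)// Hu.
Qed.

Lemma smooth_ext_open (A : vbundle B) y (a : A y) :
  exists V (s : sect A), [/\ open V, V y, smooth_on V s & s y = a].
Proof.
have [s ss sE] := ssmooth_at_ext a.
by have [V [oV Vy sV]] := near_ex_open (ssmooth_at_near ss); exists V, s.
Qed.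

(** [u] is the value of a flat lift [e] of some p^# s plus a vector of K, which is itself the value
    of a flat lift. By (a), J sends both values into K^perp. *)
Lemma perp_stable x u :
  preserves_flat_lifts D J -> perp K x u -> perp K x (J u).
Proof.
move=> pJ Ku; have [a aE] := Phi_onto (pr u).
have [V [s [oV Vx sV sE]]] := smooth_ext_open a.
have oW : open (p @^-1` V) by apply: open_comp => // y _; exact: cp.
have [U [e [oU Ux _ le eq]]] := flat_lift_exists oW Vx (th_flat holP oV sV).
have [_ Ke _] := le; have [_ KJe _] := pJ U e oU le.
have Kk : K x (u - e (i x)).
  by apply/pr_eqP => //; [exact: Ke|rewrite eq// /psharp sE aE].
have [U' [k [oU' U'x lk kE]]] := K_flat_lift Kk.
have [_ KJk _] := pJ U' k oU' lk.
have := perp_linear 1 (KJk x U'x) (KJe x Ux).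
by rewrite -(gc_linear gcJ) kE scale1r subrK.
Qed.

(** For v in K^perp, the pairing of J u with v is minus that of u with J v, and J v is in K^perp. *)
Lemma K_stable x u : preserves_flat_lifts D J -> K x u -> K x (J u).
Proof.
move=> pJ Ku; apply: perp_perp => v Kv.
rewrite (gc_skew gcJ) met_sym (perp_stable pJ Kv) ?oppr0//.
Qed.

(** Jquot is defined through arbitrary pointwise lifts; J K <= K makes the result independent of the
    lift. *)
Lemma quotient_map_exists : preserves_flat_lifts D J ->
  exists Jq : forall x, Q x -> Q x, quotient_map J Jq.
Proof.
move=> pJ.
pose lft x (q : Q x) := s2val (cid2 (q_onto quot q)).
have Kl x (q : Q x) : perp K x (lft x q) := s2valP (cid2 (q_onto quot q)).
have lE x (q : Q x) : pr (lft x q) = q := s2valP' (cid2 (q_onto quot q)).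
exists (fun x q => pr (J (lft x q))) => x u Ku; split; first exact: perp_stable.
apply/pr_eqP; [exact: perp_stable|exact: perp_stable|].
have : K x (J (lft x (pr u) - u)) by apply: K_stable => //; apply/pr_eqP.
have lJ := @gc_linear _ _ _ _ gcJ (i x).
by rewrite (linear_funD lJ) (linear_funN lJ).
Qed.

(** Through [Phi], [q] becomes a section of p^*Ered, that is, locally a combination of pulled back
    sections [b j], and each p^# b_j is flat. *)
Lemma smooth_flat_comb x (q : sect Q) : ssmooth_at x q ->
  exists r (c : 'I_r -> N -> R) (qf : 'I_r -> sect Q) V,
    [/\ open V, V x, forall j, smooth_at x (c j), forall j, flat_on V (qf j)
      & \forall y \near x, q y = \sum_j c j y *: qf j y].
Proof.
move=> sq.
pose s : sect (pullback p Ered) := fun y => sval (cid (Phi_onto (q y))).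
have sE y : Phi (s y) = q y := svalP (cid (Phi_onto (q y))).
have [r [c [b [sc sb sbE]]]] : ssmooth_at x s.
  apply/(th_smooth holP); rewrite (_ : (fun y => Phi (s y)) = q)//.
  exact: functional_extensionality_dep.
have nb : \forall y \near p x, forall j, ssmooth_at y (b j).
  by apply: filter_forall => j; exact: ssmooth_at_near.
have [V [oV Vx VP]] := near_ex_open nb.
exists r, c, (fun j => psharp Phi (b j)), (p @^-1` V); split=> //.
- by apply: open_comp => // y _; exact: cp.
- by move=> j; apply: (th_flat holP oV) => y /VP.
- apply: filterS sbE => y sbE; rewrite -sE sbE.
  exact: linear_fun_sum (@th_linear _ _ _ _ _ _ _ _ holP y) _ _ _.
Qed.

(** Write q = sum_j c_j q_j near x with flat q_j. The Jq q_j are flat too, so the Leibniz rule turns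
    both sides into the sum of the Z(c_j) Jq(q_j). *)
Lemma K_of_preserves_flat :
  preserves_flat_lifts D J -> preserves_K_and_flat D J.
Proof.
move=> pJ; split=> [x u|]; first exact: K_stable.
have [Jq JqP] := quotient_map_exists pJ; exists Jq => // V Z q _ _ FZ sq x Vx.
have lJq y := quotient_map_linear gcJ JqP (x := y).
have Fx := FZ x Vx; have sqx := sq x Vx.
have [r [c [qf [W [oW Wx sc fqf qE]]]]] := smooth_flat_comb sqx.
have fJqf j := quotient_map_flat JqP pJ oW (fqf j).
have sqf j : ssmooth_at x (qf j) by case: (fqf j) => + _; exact.
have sJqf j : @ssmooth_at R N Q x (fun y => Jq y (qf j y)).
  by case: (fJqf j) => + _; exact.
have n0 j : cnabla D (Z x) (qf j) = 0 by case: (fqf j) => _; exact.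
have nJ0 j : cnabla D (Z x) (fun y => Jq y (qf j y)) = 0.
  by case: (fJqf j) => _; exact.
have JqE : \forall y \near x, \sum_j c j y *: Jq y (qf j y) = Jq y (q y).
  by apply: filterS qE => y ->; rewrite (linear_fun_sum (lJq y)).
have sJq := ssmooth_at_lin sc sJqf.
rewrite -(n_local conn Fx sJq JqE) (n_local conn Fx sqx qE).
rewrite (nabla_flat_comb Fx sc sJqf nJ0) (nabla_flat_comb Fx sc sqf n0).
by rewrite (linear_fun_sum (lJq x)).
Qed.

(** * Construction of Jred *)

Section Construction.
Hypothesis pJ : preserves_flat_lifts D J.
Context {Jq : forall x, Q x -> Q x}.
Hypothesis JqP : quotient_map J Jq.

Let lJq x : linear (@Jq x). Proof. exact: (quotient_map_linear gcJ JqP). Qed.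

Lemma descend_section (V : set B) (s : sect Ered) : open V -> smooth_on V s ->
  exists2 s' : sect Ered, smooth_on V s'
    & forall x, V (p x) -> Jq (Phi (s (p x))) = Phi (s' (p x)).
Proof.
move=> oV sV.
have oW : open (p @^-1` V) by apply: open_comp => // y _; exact: cp.
exact: (th_onto holP oV) (quotient_map_flat JqP pJ oW (th_flat holP oV sV)).
Qed.

(** A vector over [y] is extended to a section [s], and the section [s'] with p^# s' = Jq (p^# s) is
    evaluated at [y]. The single value [s' y] serves every [x] in the fibre over [y], so a choice
    made for [y] and [a] alone suffices. *)
Lemma reduced_map_exists : exists Jr : forall y, Ered y -> Ered y,
  forall x a, Phi (Jr (p x) a) = Jq (@Phi x a).
Proof.
have H y (a : Ered y) : exists b : Ered y, exists s s' : sect Ered,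
    [/\ s y = a, s' y = b
      & forall x, p x = y -> Jq (Phi (s (p x))) = Phi (s' (p x))].
  have [V [s [oV Vy sV sE]]] := smooth_ext_open a.
  have [s' _ s'E] := descend_section oV sV.
  by exists (s' y), s, s'; split=> // x xy; apply: s'E; rewrite xy.
exists (fun y a => sval (cid (H y a))) => x a.
case: cid => /= b [s [s' [sE s'E /(_ x erefl)]]].
by rewrite sE s'E.
Qed.

Context {Jr : forall y, Ered y -> Ered y}.
Hypothesis JrP : forall x a, Phi (Jr (a : Ered (p x))) = Jq (@Phi x a).

Lemma reduced_map_induces : induces J Phi Jr.
Proof.
move=> x a u Ku ua; have [KJu JqE] := JqP Ku; split=> //.
by rewrite JrP -ua.
Qed.

(** As p is onto and [Phi] injective, Jr s coincides on [V] with the smooth section to which Jq (p^#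
    s) descends. *)
Lemma reduced_map_smooth (V : set B) (s : sect Ered) :
  open V -> smooth_on V s ->
  @smooth_on R B Ered V (fun y => Jr (s y)).
Proof.
move=> oV sV; have [s' sV' s'E] := descend_section oV sV.
move=> y Vy; apply: ssmooth_at_eq (sV' y Vy).
apply: (near_open oV Vy) => z; have [_ ponto _ _ _] := simp.
have [x <-] := ponto z => Vz.
by apply: (@Phi_inj x); rewrite JrP s'E.
Qed.

(** Every point of the base is some [p x], and [Phi] is injective there (metric-preserving for
    skewness), so each identity follows from that of J on lifts in K^perp. *)
Lemma reduced_gen_complex : gen_complex Jr.
Proof.
have [_ ponto _ _ _] := simp.
have lPhi x := @th_linear _ _ _ _ _ _ _ _ holP x.
have lift x (a : Ered (p x)) : exists u, perp K x u /\ pr u = Phi a.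
  by have [u Ku ua] := q_onto quot (Phi a); exists u.
split.
- move=> y; have [x <-] := ponto y => a u v.
  by apply: (@Phi_inj x); rewrite JrP !lPhi !JrP lJq.
- move=> y s ss; have [V [oV Vy sV]] := near_ex_open (ssmooth_at_near ss).
  exact: reduced_map_smooth oV sV y Vy.
- move=> y; have [x <-] := ponto y => a.
  have [u [Ku ua]] := lift x a; have [KJu Ju] := JqP Ku.
  have [_ JJu] := JqP KJu.
  apply: (@Phi_inj x).
  rewrite !JrP (linear_funN (lPhi x)) -ua Ju JJu (gc_sq gcJ).
  by rewrite -sub0r prB ?pr0 ?sub0r//; exact: perp0.
- move=> y; have [x <-] := ponto y => a b.
  have [[u [Ku ua]] [v [Kv vb]]] := (lift x a, lift x b).
  have [[KJu Ju] [KJv Jv]] := (JqP Ku, JqP Kv).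
  rewrite !(red_met redP) !JrP -ua -vb Ju Jv !(q_met quot)//.
  exact: gc_skew.
(* For the torsion, [s1] and [s2] are lifted over one common [U]. By (a), J e1 and J e2 are flat
   lifts of Jr s1 and Jr s2 there, so all four brackets in [Ered] are classes of brackets in [E]. *)
- move=> y; have [x <-] := ponto y => s1 s2 ss1 ss2 Js1 Js2.
  have n12 : \forall y \near p x, ssmooth_at y s1 /\ ssmooth_at y s2.
    by apply: filterS2 (ssmooth_at_near ss1) (ssmooth_at_near ss2).
  have [V [oV Vx V12]] := near_ex_open n12.
  have V1 : smooth_on V s1 by move=> z /V12[].
  have V2 : smooth_on V s2 by move=> z /V12[].
  have oW : open (p @^-1` V) by apply: open_comp => // z _; exact: cp.
  have [f1 f2] := (th_flat holP oV V1, th_flat holP oV V2).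
  have [U1 [e1 [oU1 U1x U1V le1 eq1]]] := flat_lift_exists oW Vx f1.
  have [U2 [e2 [oU2 U2x U2V le2 eq2]]] := flat_lift_exists oW Vx f2.
  pose U := U1 `&` U2; have oU : open U by exact: openI.
  have l1 : flat_lift D U e1 by apply: flat_liftS le1 => ? [].
  have l2 : flat_lift D U e2 by apply: flat_liftS le2 => ? [].
  have UV z : U (i z) -> V (p z) by move=> [/U1V].
  have q1 z : U (i z) -> pr (e1 (i z)) = psharp Phi s1 z by move=> [/eq1].
  have q2 z : U (i z) -> pr (e2 (i z)) = psharp Phi s2 z by move=> [_ /eq2].
  have Jq' e s : flat_lift D U e ->
      (forall z, U (i z) -> pr (e (i z)) = psharp Phi s z) ->
      forall z, U (i z) -> pr (J (e (i z))) = psharp Phi (fun y => Jr (s y)) z.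
    move=> [_ Ke _] qe z Uz.
    by rewrite -(JqP (Ke z Uz)).2 qe// /psharp JrP.
  have Ux : U (i x) by [].
  have [_ _ _ brD] := redD.
  (* Reducibility places the bracket of flat lifts in K^perp, where Jq and the additivity of [pr]
     apply to it. *)
  have brP g1 g2 a1 a2 : flat_lift D U g1 -> flat_lift D U g2 ->
      smooth_on V a1 -> smooth_on V a2 ->
      (forall z, U (i z) -> pr (g1 (i z)) = psharp Phi a1 z) ->
      (forall z, U (i z) -> pr (g2 (i z)) = psharp Phi a2 z) ->
      perp K x (br g1 g2 (i x)) /\ Phi (br a1 a2 (p x)) = pr (br g1 g2 (i x)).
    move=> lf1 lf2 sa1 sa2 qf1 qf2.
    have [_ Kbr _] := brD U g1 g2 oU lf1 lf2; split; first exact: Kbr.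
    exact: (red_br redP oU oV UV lf1 lf2 sa1 sa2 qf1 qf2 Ux).
  have lJ1 := pJ oU l1; have lJ2 := pJ oU l2.
  have VJ1 := reduced_map_smooth oV V1; have VJ2 := reduced_map_smooth oV V2.
  have qJ1 := Jq' _ _ l1 q1; have qJ2 := Jq' _ _ l2 q2.
  have [K11 b11] := brP _ _ _ _ lJ1 lJ2 VJ1 VJ2 qJ1 qJ2.
  have [K12 b12] := brP _ _ _ _ lJ1 l2 VJ1 V2 qJ1 q2.
  have [K21 b21] := brP _ _ _ _ l1 lJ2 V1 VJ2 q1 qJ2.
  have [K22 b22] := brP _ _ _ _ l1 l2 V1 V2 q1 q2.
  have [[KJ12 J12] [KJ21 J21]] := (JqP K12, JqP K21).
  have sub (a b : Ered (p x)) : @Phi x (a - b) = Phi a - Phi b.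
    by rewrite (linear_funD (lPhi x)) (linear_funN (lPhi x)).
  apply: (@Phi_inj x); rewrite !sub !JrP b11 b12 b21 b22 J12 J21.
  (* [pr] is additive only on K^perp, so the differences are collected one at a time, each partial
     one staying in K^perp. *)
  have K1 := perpB K11 KJ12; have K2 := perpB K1 KJ21.
  rewrite -(prB K11 KJ12) -(prB K1 KJ21) -(prB K2 K22).
  have [[se1 _ _] [se2 _ _]] := (l1, l2).
  by rewrite (gc_torsion gcJ (se1 _ Ux) (se2 _ Ux)) pr0 (linear_fun0 (lPhi x)).
Qed.

End Construction.

End Reduced.

Theorem theorem7p3 (R : realType) (M : manifold R) (E : courant M)
  (D : coisotropic_data E) (B : manifold R) (p : cN D -> B)
  (Ered : courant B) (Phi : forall x, Ered (p x) -> cQ D x)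
  (J : forall x, E x -> E x) :
  reducible D -> simple_by p -> trivial_holonomy Phi -> is_reduced Phi ->
  gen_complex J ->
  (preserves_flat_lifts D J <-> preserves_K_and_flat D J) /\
  (preserves_flat_lifts D J \/ preserves_K_and_flat D J ->
   exists! Jred : forall y, Ered y -> Ered y,
     gen_complex Jred /\ induces J Phi Jred).
Proof.
move=> redD simp holP redP gcJ.
have ab : preserves_flat_lifts D J <-> preserves_K_and_flat D J.
  split; last exact: preserves_flat_of_K.
  exact: K_of_preserves_flat simp holP redP gcJ.
split=> // H; have pJ : preserves_flat_lifts D J by case: H => // /ab.
have [Jq JqP] := quotient_map_exists simp holP redP gcJ pJ.
have [Jr JrP] := reduced_map_exists simp holP pJ JqP.
have iJr := reduced_map_induces JqP JrP.
exists Jr; split.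
  split=> //.
  exact: (reduced_gen_complex redD simp holP redP gcJ pJ JqP JrP).
(* Uniqueness: p is onto, so [y] may be replaced by some [p x], where [induces] fixes the value
   through the injective [Phi]. *)
move=> Jr' [_ iJr']; apply: functional_extensionality_dep => y.
apply/funext => a; have [_ /(_ y)[x xy] _ _ _] := simp.
case: y / xy a => a.
have [u Ku ua] := q_onto (c_quot D) (Phi x a).
apply: (bij_inj (th_bij holP x)).
by rewrite (iJr x a u Ku ua).2 (iJr' x a u Ku ua).2.
Qed.
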